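(* Let $p_n\in[0,1]$ be such that $np_n(1-p_n)\to\infty$. Then with high probability $D\sim\mathbb{D}(n,p_n)$ has an $o(1)$-almost-majority bisection. That is, there is a sequence $\varepsilon_n\to0$ such that with probability tending to $1$ as $n\to\infty$, $D$ has a bisection in which all but at most $\varepsilon_n n$ vertices are majority-coloured.
   Context: $\mathbb{D}(n,p)$ is the binomial random directed graph on $n$ vertices, in which each of the $n(n-1)$ possible directed edges is present with probability $p$ independently. A bisection is a colouring of the vertices with two colours in which the sizes of the two colour classes are equal (or differ by one, if the number of vertices is odd). For a vertex-colouring of a directed graph, a vertex is majority-coloured if at most half of its out-neighbours have the same colour as it. A vertex-colouring of an $n$-vertex directed graph is an $\varepsilon$-almost-majority colouring if all but (at most) $\varepsilon n$ vertices are majority-coloured. *)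

(* Defs.v *)
From HB Require Import structures.
From mathcomp Require Import all_boot all_order all_algebra.
From mathcomp Require Import all_classical all_reals all_analysis.

Set Implicit Arguments.
Unset Strict Implicit.
Unset Printing Implicit Defensive.

Import Order.TTheory GRing.Theory Num.Theory.
Import numFieldNormedType.Exports.

Local Open Scope ring_scope.

Section MajorityColouring.
Variable V : finType.

Definition arc := {e : V * V | e.1 != e.2}.

(* Loopless directed graphs on V; the two arcs vw and wv may both be present. *)
Definition digraph := {set arc}.

Definition out_nbrs (D : digraph) (v : V) : {set V} :=
  [set (val e).2 | e in D & (val e).1 == v].

Definition colouring := {ffun V -> bool}.

Definition colour_class (c : colouring) (b : bool) : {set V} :=
  [set v | c v == b].

Definition bisection (c : colouring) : bool :=
  let a := #|colour_class c true| in
  let b := #|colour_class c false| in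
  if odd #|V| then (a == b.+1) || (b == a.+1) else a == b.

(* At most half of the out-neighbours of v share its colour; in particular
   a vertex without out-neighbours is majority-coloured. *)
Definition majority_coloured (D : digraph) (c : colouring) (v : V) : bool :=
  (2 * #|out_nbrs D v :&: colour_class c (c v)| <= #|out_nbrs D v|)%N.

Definition almost_majority (R : realType) (eps : R) (D : digraph)
    (c : colouring) : bool :=
  #|[set v | ~~ majority_coloured D c v]|%:R <= eps * #|V|%:R.

Definition has_almost_majority_bisection (R : realType) (eps : R)
    (D : digraph) : bool :=
  [exists c : colouring, bisection c && almost_majority eps D c].

End MajorityColouring.

Section BinomialDigraph.
Variables (R : realType) (n : nat) (p : R).

Definition binomial_digraph_mass (D : digraph 'I_n) : R :=
  \prod_(e : arc 'I_n) (if e \in D then p else 1 - p).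

Definition binomial_digraph_prob (E : pred (digraph 'I_n)) : R :=
  \sum_(D : digraph 'I_n | E D) binomial_digraph_mass D.

Lemma binomial_digraph_mass_ge0 (D : digraph 'I_n) :
  0 <= p <= 1 -> 0 <= binomial_digraph_mass D.
Proof.
move=> /andP[p0 p1]; apply: prodr_ge0 => e _.
by case: ifP => // _; rewrite subr_ge0.
Qed.

Lemma binomial_digraph_probT : binomial_digraph_prob predT = 1.
Proof.
rewrite /binomial_digraph_prob /binomial_digraph_mass -bigA_distr.
by rewrite big1 // => e _ /=; rewrite addrCA subrr addr0.
Qed.

End BinomialDigraph.

(* Main.v *)
Require Import Defs.
From HB Require Import structures.
From mathcomp Require Import all_boot all_order all_algebra.
From mathcomp Require Import all_classical all_reals all_analysis.
From mathcomp Require Import ring lra zify.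

Set Implicit Arguments.
Unset Strict Implicit.
Unset Printing Implicit Defensive.

Import Order.TTheory GRing.Theory Num.Theory.
Import numFieldNormedType.Exports.

Local Open Scope ring_scope.

(** Why the theorem is true.

    Read the random digraph row by row: the out-neighbourhoods of the vertices
    are independent random sets of a common law, and for a fixed colouring [c]
    whether [v] is majority-coloured depends on row [v] alone.

    Count the bisections that majority-colour every vertex.  In one bisection
    each vertex is majority-coloured with probability at least [1/2], because
    its own class without [v] is no larger than the other class
    ([majority_in_half]); so the mean count is at least
    [2^-n * #bisections >= 1 / (n + 1)] ([perfect_bisections_mean]).

    For the second moment take a pair [(c, c')].  Writing [A] and [A'] for the
    numbers of out-neighbours of colour [true] minus those of colour [false]
    under [c] and [c'], vertex [v] is good for both colourings only if [A] and
    [A'] have, up to an error of one, the signs prescribed by [(c v, c' v)].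
    The four sign patterns partition the probability space up to the event that
    [A] or [A'] is in [-1, 1], which is unlikely since [n p (1 - p)] is large
    ([imbalance_anticoncentration]).  So each pair contributes
    [\prod_v q (c v, c' v)] for four numbers [q] of sum [1 + o(1)].  If [q] were
    the same for all pairs, the sum over the pairs would be exactly
    [(1 + o(1))^n]; as [q] ranges over a bounded region, rounding it to a finite
    grid gives the same bound up to a constant factor
    ([sum_coloured_prod_le]).  Correlations between overlapping bisections thus
    never have to be computed, and the count is positive with probability at
    least [exp (- o(n))] ([second_moment_bound]).

    Finally let [M] be the least number of vertices that a bisection leaves
    badly coloured.  Changing one row changes [M] by at most one, so
    [E exp (- lam M) <= exp (- lam E M + 2 lam^2 n)]
    ([exp_moment_bounded_differences]), while the left side is at least
    [P (M = 0) >= exp (- o(n))].  Hence [E M = o(n)] ([min_defects_mean]), and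
    Markov's inequality finishes the proof with
    [eps_n = sqrt (E M / n) + 1 / (n + 1)], where the second term only makes
    [eps_n] positive. *)

(** * Expectations over finite probability spaces *)

Section Expectation.
Variables (R : realFieldType) (T : finType).

Definition distribution (w : T -> R) := (forall t, 0 <= w t) /\ \sum_t w t = 1.

Definition expect (w F : T -> R) : R := \sum_t w t * F t.

Variable w : T -> R.
Hypothesis wP : distribution w.

Lemma expect_cst (a : R) : expect w (fun=> a) = a.
Proof. by rewrite /expect -mulr_suml wP.2 mul1r. Qed.

Lemma expectZ (a : R) (F : T -> R) :
  expect w (fun t => a * F t) = a * expect w F.
Proof. by rewrite mulr_sumr; apply: eq_bigr => t _; rewrite mulrCA. Qed.

Lemma expectD (F G : T -> R) :
  expect w (fun t => F t + G t) = expect w F + expect w G.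
Proof. by rewrite -big_split; apply: eq_bigr => t _; rewrite mulrDr. Qed.

Lemma expect_sum (I : finType) (P : pred I) (F : I -> T -> R) :
  expect w (fun t => \sum_(i | P i) F i t) = \sum_(i | P i) expect w (F i).
Proof.
rewrite /expect exchange_big; apply: eq_bigr => t _.
by rewrite mulr_sumr.
Qed.

Lemma eq_expect (F G : T -> R) : F =1 G -> expect w F = expect w G.
Proof. by move=> eFG; apply: eq_bigr => t _; rewrite eFG. Qed.

Lemma ler_expect (F G : T -> R) :
  (forall t, F t <= G t) -> expect w F <= expect w G.
Proof.
move=> leFG; apply: ler_sum => t _.
by rewrite ler_wpM2l ?leFG //; apply: wP.1.
Qed.

Lemma expect_ge0 (F : T -> R) : (forall t, 0 <= F t) -> 0 <= expect w F.
Proof. by move=> F0; apply: sumr_ge0 => t _; rewrite mulr_ge0 ?wP.1. Qed.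

Lemma expect_le1 (F : T -> R) : (forall t, F t <= 1) -> expect w F <= 1.
Proof. by move=> F1; rewrite -[leRHS]expect_cst; apply: ler_expect. Qed.

(** The inequality [x <= (a x^2 + [x != 0] / a) / 2] holds for every [a > 0];
    averaging it with the optimal [a = E X / E X^2] gives the claim. *)
Lemma second_moment_bound (X : T -> R) :
  0 < expect w X ->
  (expect w X) ^+ 2 <=
    expect w (fun t => X t ^+ 2) * expect w (fun t => (X t != 0)%:R).
Proof.
move=> m_gt0; set m := expect w X in m_gt0 *.
set s := expect w _; set q := expect w _.
have bound a : 0 < a -> 2 * m <= a * s + a^-1 * q.
  move=> a_gt0; rewrite /m /s /q -!expectZ -expectD; apply: ler_expect => t.
  have [->|_] /= := eqVneq (X t) 0; first by rewrite expr0n /= !mulr0 addr0.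
  rewrite mulr1 -subr_ge0.
  suff -> : a * X t ^+ 2 + a^-1 - 2 * X t = a^-1 * (a * X t - 1) ^+ 2.
    by rewrite mulr_ge0 ?sqr_ge0 // invr_ge0 ltW.
  by field; rewrite gt_eqF.
have q1 : q <= 1 by apply: expect_le1 => t; case: (_ != _).
have q0 : 0 <= q by apply: expect_ge0 => t.
have s_gt0 : 0 < s.
  rewrite lt_def expect_ge0 ?andbT; last by move=> t; exact: sqr_ge0.
  apply/eqP => s0; have := bound (m^-1) (ltac:(by rewrite invr_gt0)).
  rewrite s0 mulr0 add0r invrK => le2m.
  have : m * q <= m by rewrite ler_piMr // ltW.
  lra.
have := bound (m / s) (divr_gt0 m_gt0 s_gt0).
rewrite divfK ?gt_eqF // invf_div => le2m.
have : m <= s / m * q by lra.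
by rewrite mulrAC ler_pdivlMr // expr2.
Qed.

End Expectation.

Section Independence.
Variables (R : realFieldType) (I T : finType) (w : T -> R).

Definition iid (f : {ffun I -> T}) : R := \prod_i w (f i).

Lemma expect_iid_prod (g : I -> T -> R) :
  expect iid (fun f => \prod_i g i (f i)) = \prod_i expect w (g i).
Proof.
rewrite [RHS]bigA_distr_bigA; apply: eq_bigr => f _.
by rewrite -big_split.
Qed.

Hypothesis wP : distribution w.

Lemma iid_distribution : distribution iid.
Proof.
split=> [f|]; first by apply: prodr_ge0 => i _; apply: wP.1.
rewrite /iid -(bigA_distr_bigA (fun=> w)).
by apply: big1 => i _; apply: wP.2.
Qed.

Definition update (f : {ffun I -> T}) (i : I) (t : T) : {ffun I -> T} :=
  [ffun j => if j == i then t else f j].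

(** Replacing one coordinate by an independent fresh copy does not change the
    law: exchanging the old and the new value is an involution of the pairs
    (configuration, fresh value) that preserves their weight. *)
Lemma expect_resample (i : I) (F : {ffun I -> T} -> R) :
  expect iid F = expect iid (fun f => expect w (fun t => F (update f i t))).
Proof.
pose swap (ft : {ffun I -> T} * T) := (update ft.1 i ft.2, ft.1 i).
have swapK : involutive swap.
  move=> [f t]; rewrite /swap /= ffunE eqxx; congr pair.
  by apply/ffunP => j; rewrite !ffunE; case: eqP => [->|].
transitivity (\sum_(ft : {ffun I -> T} * T) iid ft.1 * w ft.2 * F ft.1).
  rewrite -(pair_bigA _ (fun f t => iid f * w t * F f)) /=.
  apply: eq_bigr => f _; rewrite -mulr_suml -mulr_sumr.
  by rewrite wP.2 mulr1.
rewrite (reindex_inj (inv_inj swapK)) /=.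
rewrite -(pair_bigA _ (fun f t =>
  iid (update f i t) * w (f i) * F (update f i t))) /=.
apply: eq_bigr => f _; rewrite mulr_sumr; apply: eq_bigr => t _.
rewrite mulrA; congr (_ * _).
rewrite /iid (bigD1 i) //= [X in _ = X * _](bigD1 i) //=.
rewrite ffunE eqxx mulrAC [RHS]mulrAC.
congr (_ * _); first exact: mulrC.
by apply: eq_bigr => j /negPf ji; rewrite ffunE ji.
Qed.

End Independence.

(** * Exponential moments under bounded differences *)

Section BoundedDifferences.
Variable R : realType.

Lemma expR_le_quadratic (x : R) : x <= 2^-1 -> expR x <= 1 + x + 2 * x ^+ 2.
Proof.
move=> xh; have x1 : 0 < 1 - x by lra.
have le_inv : expR x <= (1 - x)^-1.
  rewrite -[x in leLHS]opprK expRN lef_pV2 ?posrE ?expR_gt0 //.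
  exact: expR_ge1Dx.
apply: le_trans le_inv _; rewrite -[leLHS]mul1r ler_pdivrMr //.
rewrite -subr_ge0.
have -> : (1 + x + 2 * x ^+ 2) * (1 - x) - 1 = x ^+ 2 * (1 - 2 * x) by ring.
by rewrite mulr_ge0 ?sqr_ge0 //; lra.
Qed.

Variables (T : finType) (w : T -> R).
Hypothesis wP : distribution w.
Variable lam : R.
Hypothesis lam_itv : 0 <= lam <= 2^-1.

(** Centred at its mean, [G] has no linear term in the exponential, so only the
    quadratic one remains, and it is at most [2 lam^2]. *)
Lemma exp_moment_oscillation (G : T -> R) :
  (forall t u, `|G t - G u| <= 1) ->
  expect w (fun t => expR (- lam * G t)) <=
    expR (2 * lam ^+ 2) * expR (- lam * expect w G).
Proof.
move=> Gosc; have /andP[lam0 lamh] := lam_itv; set m := expect w G.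
have dev t : `|m - G t| <= 1.
  rewrite -[G t](expect_cst wP).
  rewrite -[m - _]/(m + - _) -mulN1r -expectZ -expectD ler_norml.
  rewrite -[X in X <= _ <= _](expect_cst wP).
  rewrite -[X in _ <= _ <= X](expect_cst wP).
  by apply/andP; split; apply: ler_expect => // u; have := Gosc u t;
    rewrite ler_norml => /andP[]; lra.
pose x t := lam * (m - G t).
have -> : (fun t => expR (- lam * G t)) =
    (fun t => expR (- lam * m) * expR (x t)).
  by apply/funext => t; rewrite -expRD /x; congr expR; ring.
rewrite expectZ mulrC; apply: ler_wpM2r; first exact/ltW/expR_gt0.
apply: (@le_trans _ _ (1 + 2 * lam ^+ 2)); last exact: expR_ge1Dx.
apply: (@le_trans _ _ (expect w (fun t =>
    (1 + 2 * lam ^+ 2) + (lam * m + - lam * G t)))).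
  apply: ler_expect => // t; have := dev t; rewrite ler_norml => /andP[d1 d2].
  apply: le_trans (@expR_le_quadratic (x t) _) _.
    rewrite /x; apply: le_trans (_ : lam * 1 <= _); last by lra.
    exact: ler_wpM2l.
  have : (m - G t) ^+ 2 <= 1.
    by rewrite -[_ ^+ 2]ger0_norm ?sqr_ge0 // normrX expr_le1 // dev.
  move/(ler_wpM2l (sqr_ge0 lam)); rewrite /x exprMn; lra.
by rewrite !expectD !expect_cst // expectZ -/m mulNr subrr addr0.
Qed.

Variable I : finType.

(** The configuration [f] with the coordinates listed in [s] taken from [g]: it
    interpolates between [f] and an independent copy. *)
Definition mix (s : seq I) (g f : {ffun I -> T}) : {ffun I -> T} :=
  [ffun i => if i \in s then g i else f i].

Definition average_over (s : seq I) (F : {ffun I -> T} -> R) f : R :=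
  expect (iid w) (fun g => F (mix s g f)).

Lemma average_over_cons (i : I) s F f : i \notin s ->
  average_over (i :: s) F f =
    expect w (fun t => average_over s F (update f i t)).
Proof.
move=> nis; rewrite /average_over (expect_resample wP i).
have -> : forall h : {ffun I -> T} -> T -> R,
    expect (iid w) (fun g => expect w (fun t => h g t)) =
    expect w (fun t => expect (iid w) (fun g => h g t)).
  move=> h; rewrite /expect.
  under eq_bigr do rewrite mulr_sumr.
  rewrite exchange_big; apply: eq_bigr => t _; rewrite mulr_sumr.
  by apply: eq_bigr => g _; rewrite mulrCA.
apply: eq_expect => t; apply: eq_expect => g; congr F.
apply/ffunP => j; rewrite !ffunE in_cons.
by case: (eqVneq j i) => [->|//]; rewrite (negPf nis).
Qed.

Variable F : {ffun I -> T} -> R.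
Hypothesis F_diff : forall f i t, `|F (update f i t) - F f| <= 1.

Lemma average_over_diff s f i t u :
  `|average_over s F (update f i t) - average_over s F (update f i u)| <= 1.
Proof.
rewrite -[_ - _]/(_ + - _) -mulN1r -expectZ -expectD.
have iP := iid_distribution I wP.
suff h g : `|F (mix s g (update f i t)) - F (mix s g (update f i u))| <= 1.
  rewrite ler_norml.
  rewrite -[X in X <= _ <= _](expect_cst iP).
  rewrite -[X in _ <= _ <= X](expect_cst iP).
  by apply/andP; split; apply: ler_expect => // g; have := h g;
    rewrite ler_norml => /andP[]; lra.
have [si|nsi] := boolP (i \in s).
  suff -> : mix s g (update f i t) = mix s g (update f i u).
    by rewrite subrr normr0.
  by apply/ffunP => j; rewrite !ffunE; case: eqP => // ->; rewrite si.
suff -> : mix s g (update f i t) = update (mix s g (update f i u)) i t.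
  exact: F_diff.
apply/ffunP => j; rewrite !ffunE.
by case: (eqVneq j i) => [->|//]; rewrite (negPf nsi).
Qed.

(** Averaging out one coordinate at a time turns [F] into its mean, and each
    step costs a factor [expR (2 lam^2)] by the one-coordinate estimate. *)
Lemma exp_moment_bounded_differences :
  expect (iid w) (fun f => expR (- lam * F f)) <=
    expR (2 * lam ^+ 2 * #|I|%:R) * expR (- lam * expect (iid w) F).
Proof.
have iP := iid_distribution I wP.
have step s : uniq s -> expect (iid w) (fun f => expR (- lam * F f)) <=
    expR (2 * lam ^+ 2 * (size s)%:R) *
    expect (iid w) (fun f => expR (- lam * average_over s F f)).
  elim: s => [_|i s IH /= /andP[nis us]].
    rewrite mulr0 expR0 mul1r; apply: ler_expect => // f.
    rewrite /average_over.
    have -> : (fun g => F (mix [::] g f)) = fun=> F f.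
      by apply/funext => g; congr F; apply/ffunP => j; rewrite ffunE.
    by rewrite expect_cst.
  apply: le_trans (IH us) _.
  rewrite -(natr1 (size s)) mulrDr mulr1 expRD -[leRHS]mulrA.
  apply: ler_wpM2l; first exact/ltW/expR_gt0.
  rewrite (expect_resample wP i) -expectZ; apply: ler_expect => // f.
  rewrite average_over_cons //; apply: exp_moment_oscillation => t u.
  exact: average_over_diff.
apply: le_trans (step (enum I) (enum_uniq I)) _.
rewrite -cardE; apply: ler_wpM2l; first exact/ltW/expR_gt0.
have -> : (fun f => expR (- lam * average_over (enum I) F f)) =
    fun=> expR (- lam * expect (iid w) F).
  apply/funext => f; congr (expR (_ * _)); apply: eq_expect => g; congr F.
  by apply/ffunP => j; rewrite ffunE mem_enum.
by rewrite expect_cst.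
Qed.

End BoundedDifferences.

(** * Anticoncentration of signed Bernoulli sums *)

Section CyclicPoincare.
Variables (R : realFieldType) (k : nat).
Implicit Type a : 'I_k.+2 -> R.

Definition energy a : R := \sum_x a x ^+ 2.
Definition dirichlet (j : 'I_k.+2) a : R := \sum_x (a x - a (x + j)) ^+ 2.

Lemma sum_translate (j : 'I_k.+2) a : \sum_x a (x + j) = \sum_x a x.
Proof. by rewrite [RHS](reindex_inj (addIr j)). Qed.

Lemma dirichletN j a : dirichlet (- j) a = dirichlet j a.
Proof.
rewrite /dirichlet -[LHS](sum_translate j); apply: eq_bigr => x _ /=.
by rewrite addrK -sqrrN opprB.
Qed.

(** A shift by [j] is a composition of [j] unit shifts, and
    [(u + v)^2 <= 2 u^2 + 2 v^2] passes from [j] to [j + 1]. *)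
Lemma dirichlet_nat (j : nat) a : dirichlet j%:R a <= 4 ^+ j * dirichlet 1 a.
Proof.
elim: j => [|j IH].
  rewrite mul1r [leLHS]big1 => [|x _]; last by rewrite addr0 subrr expr0n.
  by apply: sumr_ge0 => x _; apply: sqr_ge0.
have le2 : dirichlet j.+1%:R a <= 2 * dirichlet j%:R a + 2 * dirichlet 1 a.
  rewrite -[dirichlet 1 a](sum_translate j%:R) !mulr_sumr -big_split /=.
  apply: ler_sum => x _; rewrite -natr1 addrA -subr_ge0.
  set u := a x; set v := a (x + _); set z := a (_ + 1).
  suff -> : 2 * (u - v) ^+ 2 + 2 * (v - z) ^+ 2 - (u - z) ^+ 2 =
            (u - 2 * v + z) ^+ 2 by apply: sqr_ge0.
  by ring.
have D0 : 0 <= dirichlet 1 a by apply: sumr_ge0 => x _; apply: sqr_ge0.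
have one_le : 1 <= 4 ^+ j :> R by rewrite exprn_ege1 // ler1n.
have := ler_wpM2r D0 one_le; rewrite exprS mul1r; lra.
Qed.

(** Summing [dirichlet j a] over all shifts [j] compares any two values of [a],
    and yields twice the modulus times the excess of [energy a] over its
    minimum.  The constant is crude; it only has to depend on the modulus
    alone. *)
Lemma cyclic_poincare a : \sum_x a x = 1 ->
  energy a - k.+2%:R^-1 <= 4 ^+ k.+2 * dirichlet 1 a.
Proof.
move=> a1.
have sum_all : \sum_j dirichlet j a = 2 * k.+2%:R * energy a - 2.
  have -> : \sum_j dirichlet j a =
      \sum_x \sum_y (a x ^+ 2 + a y ^+ 2 - 2 * (a x * a y)).
    rewrite exchange_big; apply: eq_bigr => x _.
    rewrite [RHS](reindex_inj (addrI x)); apply: eq_bigr => j _ /=.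
    by ring.
  have two : \sum_x \sum_y 2 * (a x * a y) = 2.
    under eq_bigr do rewrite -mulr_sumr -mulr_sumr a1 mulr1.
    by rewrite -mulr_sumr a1 mulr1.
  have inner x : \sum_y (a x ^+ 2 + a y ^+ 2 - 2 * (a x * a y)) =
      k.+2%:R * a x ^+ 2 + (energy a - \sum_y 2 * (a x * a y)).
    by rewrite !big_split sumrN sumr_const card_ord mulr_natl addrA.
  under eq_bigr do rewrite inner.
  rewrite big_split -mulr_sumr sumrB two sumr_const card_ord -/(energy a).
  rewrite -[energy a *+ _]mulr_natl.
  rewrite -[LHS]/(k.+2%:R * energy a + (k.+2%:R * energy a - 2)); ring.
have D0 : 0 <= dirichlet 1 a by apply: sumr_ge0 => x _; apply: sqr_ge0.
have : \sum_j dirichlet j a <= \sum_(j < k.+2) 4 ^+ k.+2 * dirichlet 1 a.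
  apply: ler_sum => j _; rewrite -[j in leLHS]natr_Zp.
  apply: le_trans (dirichlet_nat _ _) _; apply: ler_wpM2r => //.
  by rewrite ler_eXn2l ?ltr1n // ltnW.
rewrite sum_all sumr_const card_ord -[leRHS]mulr_natl => bound.
have k0 : 0 < k.+2%:R :> R by rewrite ltr0n.
rewrite -(ler_pM2l k0) mulrBr divff ?gt_eqF //.
have : 0 <= k.+2%:R * (4 ^+ k.+2 * dirichlet 1 a) :> R.
  by apply: mulr_ge0; [exact: ltW | apply: mulr_ge0 => //; exact: exprn_ge0].
lra.
Qed.

End CyclicPoincare.

Section RandomSet.
Variables (R : realType) (p : R).

Definition bernoulli (b : bool) : R := if b then p else 1 - p.

Hypothesis p01 : 0 <= p <= 1.

Lemma bernoulli_distribution : distribution bernoulli.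
Proof.
case/andP: p01 => p0 p1; split=> [[]|]; rewrite /bernoulli ?subr_ge0 //.
by rewrite big_bool /= addrC subrK.
Qed.

Variable V : finType.

Section Walk.
Variables (k : nat) (e : V -> 'I_k.+2).
Hypothesis e_unit : forall v, e v = 1 \/ e v = - 1.

Definition walk (s : seq V) (W : {ffun V -> bool}) : 'I_k.+2 :=
  \sum_(v <- s) if W v then e v else 0.

Definition walk_law (s : seq V) (x : 'I_k.+2) : R :=
  expect (iid bernoulli) (fun W => (walk s W == x)%:R).

Lemma walk_law_sum s : \sum_x walk_law s x = 1.
Proof.
rewrite /walk_law -expect_sum.
have iP := iid_distribution V bernoulli_distribution.
rewrite -[RHS](expect_cst iP); apply: eq_expect => W.
rewrite (bigD1 (walk s W)) //= eqxx big1 ?addr0 // => x.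
by rewrite eq_sym => /negPf ->.
Qed.

Lemma walk_law_cons v s x : v \notin s ->
  walk_law (v :: s) x = p * walk_law s (x - e v) + (1 - p) * walk_law s x.
Proof.
move=> nvs; rewrite {1}/walk_law (expect_resample bernoulli_distribution v).
rewrite -!expectZ -expectD; apply: eq_expect => W.
have walk_upd b :
    walk (v :: s) (update W v b) = (if b then e v else 0) + walk s W.
  rewrite /walk big_cons ffunE eqxx; congr (_ + _).
  apply: eq_big_seq => u us; rewrite ffunE; case: eqP => // uv.
  by rewrite -uv us in nvs.
rewrite /expect big_bool /= !walk_upd add0r.
by rewrite (can2_eq (addKr _) (addNKr _)) (addrC x).
Qed.

Let rate : R := 4^-1 ^+ k.+2 * (p * (1 - p)).

Lemma rate_itv : 0 <= rate <= 1.
Proof.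
case/andP: p01 => p0 p1; have q0 : 0 <= 1 - p by lra.
apply/andP; split.
  by apply: mulr_ge0; [apply: exprn_ge0; rewrite invr_ge0 | apply: mulr_ge0].
apply: mulr_ile1; [|exact: mulr_ge0| |apply: mulr_ile1 => //; lra].
  by apply: exprn_ge0; rewrite invr_ge0.
by apply: exprn_ile1; rewrite ?invr_ge0 // invf_le1 // ler1n.
Qed.

(** A lazy step averages the law with a translate of itself; the loss of energy
    is [p (1 - p)] times the Dirichlet form, hence a fixed proportion of the
    distance to the uniform law. *)
Lemma walk_energy_step v s : v \notin s ->
  energy (walk_law (v :: s)) - k.+2%:R^-1 <=
    (1 - rate) * (energy (walk_law s) - k.+2%:R^-1).
Proof.
move=> nvs; set a := walk_law s.
have eD : dirichlet (- e v) a = dirichlet 1 a.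
  by rewrite dirichletN; case: (e_unit v) => ->; rewrite ?dirichletN.
have -> : energy (walk_law (v :: s)) = energy a - p * (1 - p) * dirichlet 1 a.
  have -> : energy a = p * (\sum_x a (x - e v) ^+ 2) + (1 - p) * energy a.
    by rewrite (sum_translate (- e v) (fun x => a x ^+ 2)) -/(energy a); ring.
  rewrite -eD /energy /dirichlet !mulr_sumr -sumrN -!big_split /=.
  by apply: eq_bigr => x _; rewrite walk_law_cons // -/a; ring.
have := cyclic_poincare (walk_law_sum s); rewrite -/a.
set D := dirichlet 1 a; set E := energy a - _ => le4.
have /andP[q0 _] := rate_itv.
have := ler_wpM2l q0 le4.
have -> : rate * (4 ^+ k.+2 * D) = p * (1 - p) * D.
  have f0 : 4 ^+ k.+2 != 0 :> R by rewrite expf_neq0 // pnatr_eq0.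
  by rewrite /rate exprVn; field.
by move=> le5; rewrite [leRHS]mulrBl mul1r addrAC -/E lerD2l lerN2.
Qed.

Lemma walk_energy s : uniq s ->
  energy (walk_law s) - k.+2%:R^-1 <=
    expR (- (rate * (size s)%:R)).
Proof.
have /andP[q0 q1] := rate_itv.
elim: s => [_|v s IH /= /andP[nvs us]].
  rewrite mulr0 oppr0 expR0.
  have le1 x : walk_law [::] x ^+ 2 <= walk_law [::] x.
    have l0 : 0 <= walk_law [::] x.
      apply: expect_ge0 => //; exact: iid_distribution bernoulli_distribution.
    rewrite expr2 ler_piMl //; apply: expect_le1 => [|W]; last by case: eqP.
    exact: iid_distribution bernoulli_distribution.
  apply: (@le_trans _ _ (energy (walk_law [::]))).
    by rewrite lerBlDr lerDl invr_ge0.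
  by rewrite -(walk_law_sum [::]); apply: ler_sum.
apply: le_trans (walk_energy_step nvs) _.
rewrite -(natr1 (size s)) [rate * _]mulrDr mulr1 opprD expRD [leLHS]mulrC.
apply: le_trans (ler_wpM2r _ (IH us)) _; first by rewrite subr_ge0.
apply: ler_wpM2l; first exact/ltW/expR_gt0.
by apply: le_trans (expR_ge1Dx _); rewrite lexx.
Qed.

End Walk.

Definition imbalance (c : {ffun V -> bool}) (W : {ffun V -> bool}) : int :=
  \sum_v if W v then (if c v then 1 else -1) else 0.

(** Modulo [K = k + 2] the law of the sum is nearly uniform once the variance is
    large, so no residue has probability much above [sqrt (1 / K)], the bound
    that the energy gives; the values [-1], [0], [1] occupy at most three
    residues. *)
Lemma imbalance_anticoncentration_mod (k : nat) c (delta : R) :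
  0 <= delta ->
  k.+2%:R^-1 + expR (- (4^-1 ^+ k.+2 * (#|V|%:R * p * (1 - p)))) <=
    delta ^+ 2 ->
  expect (iid bernoulli) (fun W => (`|imbalance c W| <= 1)%R%:R) <= 3 * delta.
Proof.
move=> d0 hd.
pose e v : 'I_k.+2 := if c v then 1 else - 1.
have eu v : e v = 1 \/ e v = - 1 by rewrite /e; case: (c v); [left|right].
have iP := iid_distribution V bernoulli_distribution.
have walkE W : walk e (enum V) W = (imbalance c W)%:~R.
  rewrite /walk big_enum /= rmorph_sum; apply: eq_bigr => v _ /=.
  by rewrite /e; case: (W v) => //; case: (c v).
have atom x : walk_law e (enum V) x <= delta.
  have l0 : 0 <= walk_law e (enum V) x by apply: expect_ge0.
  rewrite -(ler_pXn2r (n := 2)) ?nnegrE //.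
  have le_en : walk_law e (enum V) x ^+ 2 <= energy (walk_law e (enum V)).
    by rewrite /energy (bigD1 x) //= lerDl sumr_ge0 // => y _; apply: sqr_ge0.
  apply: le_trans le_en _; apply: le_trans hd.
  rewrite -lerBlDl; apply: le_trans (walk_energy eu (enum_uniq V)) _.
  rewrite -cardE ler_expR lerN2 le_eqVlt; apply/orP; left; apply/eqP; ring.
apply: (@le_trans _ _ (walk_law e (enum V) 0 + walk_law e (enum V) 1 +
                       walk_law e (enum V) (- 1))); last first.
  by have := atom 0; have := atom 1; have := atom (- 1); lra.
rewrite /walk_law -!expectD; apply: (ler_expect iP) => W; rewrite !walkE.
case: (boolP (`|imbalance c W| <= 1)) => [|_]; last by rewrite !addr_ge0.
case: (imbalance c W) => [[|[|//]]|[|//]] _.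
- rewrite (_ : (Posz 0)%:~R = 0 :> 'I_k.+2) // eqxx.
  by rewrite -addrA lerDl addr_ge0.
- rewrite (_ : (Posz 1)%:~R = 1 :> 'I_k.+2) // eqxx.
  by rewrite addrAC lerDr addr_ge0.
- rewrite (_ : (Negz 0)%:~R = - 1 :> 'I_k.+2) // eqxx.
  by rewrite lerDr addr_ge0.
Qed.

End RandomSet.

Lemma imbalance_anticoncentration (R : realType) (eta : R) : 0 < eta ->
  exists2 B : R, 0 < B & forall (p : R) (V : finType) (c : {ffun V -> bool}),
    0 <= p <= 1 -> B <= #|V|%:R * p * (1 - p) ->
    expect (iid (bernoulli p))
      (fun W => (`|imbalance c W| <= 1)%R%:R) <= eta.
Proof.
(* Three atoms of probability at most [eta / 3] each: half of the squared bound
   goes to [1 / K], the other half to the exponential. *)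
move=> eta0; pose d := (eta / 3) ^+ 2 / 2.
have d0 : 0 < d by rewrite divr_gt0 // exprn_gt0 // divr_gt0.
pose k := Num.trunc d^-1.
have kd : k.+2%:R^-1 <= d.
  rewrite -[leRHS]invrK lef_pV2 ?posrE ?ltr0n ?invr_gt0 //.
  have dV0 : 0 <= d^-1 by rewrite invr_ge0 ltW.
  have /andP[_ /ltW le1] := truncn_itv dV0.
  by apply: le_trans le1 _; rewrite ler_nat.
pose q : R := 4^-1 ^+ k.+2.
have q0 : 0 < q by rewrite exprn_gt0 // invr_gt0.
exists ((q * d)^-1) => [|p V c p01 leB]; first by rewrite invr_gt0 mulr_gt0.
have -> : eta = 3 * (eta / 3) by field.
apply: (@imbalance_anticoncentration_mod _ _ p01 _ k).
  by rewrite divr_ge0 // ltW.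
have -> : (eta / 3) ^+ 2 = d + d by rewrite /d; field.
apply: lerD kd _; rewrite -/q; set y := q * _.
have yd : d^-1 <= y by rewrite /y -ler_pdivrMl // -invfM.
rewrite expRN -[leRHS]invrK lef_pV2 ?posrE ?expR_gt0 ?invr_gt0 //.
apply: le_trans yd _; apply: le_trans (expR_ge1Dx y).
by rewrite lerDr.
Qed.

(** * The first moment: one bisection *)

Section SwapInvolution.
Variables (V : finType) (A B : {set V}).
Hypotheses (dAB : [disjoint A & B]) (leAB : (#|A| <= #|B|)%N).

Lemma swap_into :
  exists2 s : V -> V, involutive s & forall x, x \in A -> s x \in B.
Proof.
(* The [i]-th element of [A] is exchanged with the [i]-th element of [B]. *)
pose s x := if x \in A then nth x (enum B) (index x (enum A))
  else if (index x (enum B) < #|A|)%N then nth x (enum A) (index x (enum B))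
  else x.
have AB x : x \in A -> s x \in B.
  move=> xA; rewrite /s xA -mem_enum mem_nth // -cardE (leq_trans _ leAB) //.
  by rewrite cardE index_mem mem_enum.
exists s => // x; have [xA|nxA] := boolP (x \in A).
  have sxB := AB x xA; have idx : (index x (enum A) < #|A|)%N.
    by rewrite cardE index_mem mem_enum.
  have sxE : s x = nth x (enum B) (index x (enum A)) by rewrite /s xA.
  have nsxA : s x \notin A by rewrite (disjointFl dAB sxB).
  have isx : index (s x) (enum B) = index x (enum A).
    by rewrite sxE index_uniq ?enum_uniq // -cardE (leq_trans idx).
  rewrite /s -/(s x) (negPf nsxA) isx idx (set_nth_default x) -?cardE //.
  by rewrite nth_index // mem_enum.
have [idx|nidx] := ltnP (index x (enum B)) #|A|; last first.
  have sx : s x = x by rewrite /s (negPf nxA) ltnNge nidx.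
  by rewrite !sx.
have xB : x \in enum B by rewrite -index_mem -cardE (leq_trans idx).
have sxE : s x = nth x (enum A) (index x (enum B)).
  by rewrite /s (negPf nxA) idx.
have sxA : s x \in A by rewrite sxE -mem_enum mem_nth // -cardE.
rewrite /s -/(s x) sxA.
have -> : index (s x) (enum A) = index x (enum B).
  by rewrite sxE index_uniq ?enum_uniq // -cardE.
by rewrite (set_nth_default x) ?nth_index // index_mem.
Qed.

End SwapInvolution.

Section HalfProbability.
Variables (R : realFieldType) (V : finType) (w : bool -> R).
Hypothesis wP : distribution w.

(** An involution of the vertices that carries [A] into [B] preserves the law
    of the random set and turns every set with fewer points in [B] than in [A]
    into one with at least as many. *)
Lemma random_set_half (A B : {set V}) :
  [disjoint A & B] -> (#|A| <= #|B|)%N ->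
  2^-1 <= expect (iid w) (fun W =>
    (#|[set u in A | W u]| <= #|[set u in B | W u]|)%N%:R).
Proof.
move=> dAB leAB; have [s sK sAB] := swap_into dAB leAB.
have s_inj := inv_inj sK.
pose pull (W : {ffun V -> bool}) : {ffun V -> bool} := [ffun u => W (s u)].
have pullK : involutive pull by move=> W; apply/ffunP => u; rewrite !ffunE sK.
set h := expect _ _.
have h_pull : h = expect (iid w) (fun W =>
    (#|[set u in A | pull W u]| <= #|[set u in B | pull W u]|)%N%:R).
  rewrite /h /expect (reindex_inj (inv_inj pullK)); apply: eq_bigr => W _ /=.
  congr (_ * _); rewrite /iid (reindex_inj s_inj); apply: eq_bigr => u _ /=.
  by rewrite ffunE sK.
have iP := iid_distribution V wP.
suff : 1 <= h + h by lra.
rewrite {2}h_pull /h -expectD -[leLHS](expect_cst iP).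
apply: (ler_expect iP) => W.
case: leqP => [_|ltBA] /=; first by rewrite lerDl.
have sub (X Y : {ffun V -> bool}) : (forall u, Y (s u) = X u) ->
    (#|[set u in A | X u]| <= #|[set u in B | Y u]|)%N.
  move=> XY; rewrite -(card_imset _ s_inj); apply: subset_leq_card.
  apply/fintype.subsetP => y /imsetP[u]; rewrite inE => /andP[uA Xu] ->.
  by rewrite inE sAB //= XY.
rewrite add0r (leq_trans (sub (pull W) W _)) //.
  by move=> u; rewrite ffunE.
rewrite (leq_trans (ltnW ltBA)) // sub // => u; by rewrite ffunE sK.
Qed.

End HalfProbability.

Section Majority.
Variable V : finType.

(** The out-neighbourhood of [v] is read off a subset [W] of all the vertices by
    forgetting [v] itself, so that one law of [W] serves for every vertex. *)
Definition majority_in (c : {ffun V -> bool}) (v : V) (W : {ffun V -> bool}) :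
    bool :=
  (2 * #|[set u | (u != v) && W u && (c u == c v)]| <=
     #|[set u | (u != v) && W u]|)%N.

Lemma majority_in_compare c v W :
  majority_in c v W =
    (#|[set u in [set u | (u != v) && (c u == c v)] | W u]| <=
     #|[set u in [set u | c u != c v] | W u]|)%N.
Proof.
rewrite /majority_in.
set S := [set u | (u != v) && W u].
have -> : [set u | (u != v) && W u && (c u == c v)] =
    S :&: [set u | c u == c v] by apply/setP => u; rewrite !inE.
have -> : [set u in [set u | (u != v) && (c u == c v)] | W u] =
    S :&: [set u | c u == c v] by apply/setP => u; rewrite !inE andbAC.
have -> : [set u in [set u | c u != c v] | W u] =
    S :\: [set u | c u == c v].
  apply/setP => u; rewrite !inE; case: (eqVneq u v) => [->|//].
  by rewrite eqxx.
rewrite -[in X in (_ <= X)%N](cardsID [set u | c u == c v] S).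
by rewrite mul2n -addnn leq_add2l.
Qed.

Lemma bisection_classes (c : {ffun V -> bool}) v : bisection c ->
  (#|[set u | (u != v) && (c u == c v)]| <= #|[set u | c u != c v]|)%N.
Proof.
have classD : colour_class c (c v) :\ v = [set u | (u != v) && (c u == c v)].
  by apply/setP => u; rewrite !inE.
have classN : colour_class c (~~ c v) = [set u | c u != c v].
  by apply/setP => u; rewrite !inE; case: (c u); case: (c v).
rewrite -classD -classN /bisection.
have := cardsD1 v (colour_class c (c v)); rewrite inE eqxx add1n.
case: (c v) => /= -> ; case: ifP => _ ; rewrite ?eqSS.
- by case/orP => /eqP; lia.
- by move/eqP; lia.
- by case/orP => /eqP; lia.
- by move/eqP; lia.
Qed.

Variables (R : realFieldType) (w : bool -> R).
Hypothesis wP : distribution w.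

Lemma majority_in_half c v : bisection c ->
  2^-1 <= expect (iid w) (fun W => (majority_in c v W)%:R).
Proof.
move=> /(bisection_classes v) leAB.
rewrite (eq_expect _ (fun W =>
  congr1 (fun b : bool => b%:R) (majority_in_compare c v W))).
apply: random_set_half => //.
rewrite disjoint_subset; apply/fintype.subsetP => u.
by rewrite !inE => /andP[_ ->].
Qed.

End Majority.

Section CountBisections.

Lemma bin_le_half n m : ('C(n, m) <= 'C(n, n./2))%N.
Proof.
have up a b : (a <= b)%N -> (b <= n./2)%N -> ('C(n, a) <= 'C(n, b))%N.
  move=> /subnK <-; elim: (b - a)%N => // d IH.
  rewrite addSn => le_h; apply: leq_trans (IH (ltnW le_h)) _.
  have := mul_bin_left n (d + a); set x := 'C(n, d + a); set y := 'C(n, _) => e.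
  rewrite -(leq_pmul2l (ltn0Sn (d + a))) e leq_mul2r.
  apply/orP; right; move: le_h (odd_double_half n); lia.
have [le_h|gt_h] := leqP m n./2; first exact: up.
have [le_n|gt_n] := leqP m n; last by rewrite bin_small.
rewrite -(bin_sub le_n); apply: up => //.
move: gt_h (odd_double_half n); lia.
Qed.

Lemma pow2_le_central n : (2 ^ n <= n.+1 * 'C(n, n./2))%N.
Proof.
rewrite -[2%N]/(1 + 1)%N expnDn.
have -> : (n.+1 * 'C(n, n./2) = \sum_(i < n.+1) 'C(n, n./2))%N.
  by rewrite sum_nat_const card_ord.
by apply: leq_sum => i _; rewrite !exp1n !muln1 bin_le_half.
Qed.

Variable V : finType.

Lemma card_bisections :
  (2 ^ #|V| <= #|V|.+1 * #|[set c : {ffun V -> bool} | bisection c]|)%N.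
Proof.
apply: leq_trans (pow2_le_central _) _; rewrite leq_mul2l; apply/orP; right.
rewrite -card_draws.
pose c_of (A : {set V}) : {ffun V -> bool} := [ffun v => v \in A].
have c_inj : injective c_of.
  by move=> A B /ffunP AB; apply/setP => v; have := AB v; rewrite !ffunE.
rewrite -(card_imset _ c_inj); apply: subset_leq_card.
apply/fintype.subsetP => c /imsetP[A]; rewrite inE => /eqP cA ->; rewrite inE.
rewrite /bisection.
have -> : colour_class (c_of A) true = A.
  by apply/setP => v; rewrite inE ffunE eqb_id.
have -> : colour_class (c_of A) false = ~: A.
  by apply/setP => v; rewrite !inE ffunE eqbF_neg.
have := cardsC A; have := odd_double_half #|V|; rewrite cA.
by case: (odd #|V|) => /= ? ?; [apply/orP; right; apply/eqP|apply/eqP]; lia.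
Qed.

End CountBisections.

(** * The second moment: pairs of bisections *)

Section Rounding.
Variables (R : realType) (V C : finType) (K : nat).
Hypothesis K_gt0 : (0 < K)%N.

Let grid (i : 'I_K.+2) : R := i%:R / K%:R.

Lemma round_up (q : R) : 0 <= q <= 1 -> exists i, q <= grid i <= q + K%:R^-1.
Proof.
case/andP=> q0 q1; have K0 : 0 < K%:R :> R by rewrite ltr0n.
have Kq0 : 0 <= K%:R * q by rewrite mulr_ge0 // ltW.
have /andP[le_t lt_t] := truncn_itv Kq0.
set t := Num.trunc _ in le_t lt_t.
have tK : (t.+1 < K.+2)%N.
  by rewrite !ltnS -(ler_nat R) (le_trans le_t) // ler_piMr // ltW.
exists (Ordinal tK); rewrite /grid /= ler_pdivlMr // mulrC (ltW lt_t) /=.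
rewrite ler_pdivrMr // mulrDl mulVf ?gt_eqF // -natr1 lerD2r.
by rewrite [leRHS]mulrC.
Qed.

(** For a weight [q] that does not depend on the colouring [d], the sum over all
    [d] of [\prod_v q (d v)] is the power [(\sum_x q x) ^ #|V|].  Rounding the
    weights up to multiples of [1 / K] leaves only [(K + 2) ^ #|C|] of them, so
    letting the weight depend on [d] costs no more than this factor and the
    rounding error [1 / K] in each weight. *)
Lemma sum_coloured_prod_le (Q : {ffun V -> C} -> C -> R) (s : R) :
  0 <= s -> (forall d x, 0 <= Q d x <= 1) -> (forall d, \sum_x Q d x <= s) ->
  \sum_d \prod_v Q d (d v) <=
    (K.+2 ^ #|C|)%:R * (s + #|C|%:R / K%:R) ^+ #|V|.
Proof.
move=> s0 Q01 Qs; set t := s + _.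
have /fin_all_exists[G GP] : forall d, exists g : {ffun C -> 'I_K.+2},
    forall x, Q d x <= grid (g x) <= Q d x + K%:R^-1.
  move=> d; have /fin_all_exists[g gP] := fun x => round_up (Q01 d x).
  by exists [ffun x => g x] => x; rewrite ffunE.
pose small (g : {ffun C -> 'I_K.+2}) := \sum_x grid (g x) <= t.
have grid0 i : 0 <= grid i by rewrite divr_ge0.
have G_small d : small (G d).
  apply: le_trans (_ : \sum_x (Q d x + K%:R^-1) <= _).
    by apply: ler_sum => x _; have /andP[] := GP d x.
  by rewrite big_split sumr_const -[_ *+ _]mulr_natl lerD.
apply: (@le_trans _ _ (\sum_(d : {ffun V -> C})
    \sum_(g | small g) \prod_v grid (g (d v)))).
  apply: ler_sum => d _; rewrite (bigD1 (G d)) //=.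
  apply: (@le_trans _ _ (\prod_v grid (G d (d v)))).
    apply: ler_prod => v _; have /andP[-> _] := Q01 d (d v).
    by have /andP[-> _] := GP d (d v).
  rewrite lerDl; apply: sumr_ge0 => g _; apply: prodr_ge0 => v _; exact: grid0.
rewrite exchange_big /=.
apply: (@le_trans _ _ (\sum_(g | small g) t ^+ #|V|)).
  apply: ler_sum => g g_small.
  rewrite -(bigA_distr_bigA (fun=> fun x => grid (g x))).
  rewrite prodr_const cardT -cardE.
  rewrite lerXn2r ?nnegrE //; first by apply: sumr_ge0 => x _.
  by apply: le_trans g_small; apply: sumr_ge0 => x _.
rewrite sumr_const -[leLHS]mulr_natl; apply: ler_wpM2r.
  by apply: exprn_ge0; rewrite addr_ge0 // divr_ge0.
by rewrite ler_nat; apply: leq_trans (max_card _) _; rewrite card_ffun card_ord.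
Qed.

End Rounding.

Section Pairs.
Variables (V : finType).

(** The slack of one absorbs the contribution of [v] itself, which the imbalance
    counts although [v] is not its own out-neighbour. *)
Definition on_side (b : bool) (a : int) : bool := if b then a <= 1 else -1 <= a.

Lemma imbalanceE (c W : {ffun V -> bool}) :
  imbalance c W = (#|[set u | W u && c u]|%:Z - #|[set u | W u && ~~ c u]|%:Z).
Proof.
have cardE (P : pred V) : #|[set u | P u]|%:Z = \sum_u (P u)%:Z.
  rewrite -sum1dep_card big_mkcond /= -natz natr_sum.
  by apply: eq_bigr => u _; case: (P u).
rewrite !cardE -sumrB; apply: eq_bigr => u _.
by case: (W u); case: (c u).
Qed.

Lemma majority_in_side (c : {ffun V -> bool}) v W :
  majority_in c v W -> on_side (c v) (imbalance c W).
Proof.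
rewrite majority_in_compare imbalanceE /on_side.
have := cardsD1 v [set u | W u && (c u == c v)].
have -> : [set u | W u && (c u == c v)] :\ v =
    [set u in [set u | (u != v) && (c u == c v)] | W u].
  apply/setP => u; rewrite !inE.
  by case: (u == v); case: (W u); case: (c u == c v).
have -> : [set u in [set u | c u != c v] | W u] = [set u | W u && (c u != c v)].
  by apply/setP => u; rewrite !inE andbC.
set own := #|[set u in _ | W u]|.
have : ((v \in [set u | W u && (c u == c v)]) <= 1)%N by case: (_ \in _).
move: (nat_of_bool _) => b b1.
case: (c v).
  have -> : [set u | W u && (c u == true)] = [set u | W u && c u].
    by apply/setP => u; rewrite !inE eqb_id.
  have -> : [set u | W u && (c u != true)] = [set u | W u && ~~ c u].
    by apply/setP => u; rewrite !inE eqb_id.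
  move=> -> le_own; lia.
have -> : [set u | W u && (c u == false)] = [set u | W u && ~~ c u].
  by apply/setP => u; rewrite !inE eqbF_neg.
have -> : [set u | W u && (c u != false)] = [set u | W u && c u].
  by apply/setP => u; rewrite !inE eqbF_neg negbK.
move=> -> le_own; lia.
Qed.

Lemma sum_on_side_le (R : realFieldType) (a b : int) :
  \sum_(x : bool * bool) (on_side x.1 a && on_side x.2 b)%:R <=
    1 + (`|a| <= 1)%R%:R + 2 * (`|b| <= 1)%R%:R :> R.
Proof.
have one (d : int) :
    (on_side true d)%:R + (on_side false d)%:R = 1 + (`|d| <= 1)%R%:R :> R.
  rewrite /on_side ler_norml.
  case: (leP d 1); case: (leP (-1) d) => //=; try lia.
  by rewrite add0r addr0.
rewrite -(pair_bigA _ (fun x y => (on_side x a && on_side y b)%:R)) /=.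
under eq_bigr do under eq_bigr do rewrite -mulnb natrM.
have -> : \sum_x \sum_y (on_side x a)%:R * (on_side y b)%:R =
    (1 + (`|a| <= 1)%R%:R) * (1 + (`|b| <= 1)%R%:R) :> R.
  by rewrite -!one !big_bool /=; ring.
by case: (`|a| <= 1); case: (`|b| <= 1) => /=; lra.
Qed.

Variables (R : realType) (p eta : R).
Hypothesis p01 : 0 <= p <= 1.
Let row := iid (bernoulli p) : {ffun V -> bool} -> R.

Let rowP : distribution row.
Proof. exact: iid_distribution (bernoulli_distribution p01). Qed.

Definition perfect (f : {ffun V -> {ffun V -> bool}}) (c : {ffun V -> bool})
    : R :=
  \prod_v (majority_in c v (f v))%:R.

Definition perfect_bisections f : R := \sum_(c | bisection c) perfect f c.

Lemma perfect_bisections_mean :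
  #|V|.+1%:R^-1 <= expect (iid row) perfect_bisections.
Proof.
rewrite /perfect_bisections expect_sum.
apply: (@le_trans _ _ (\sum_(c : {ffun V -> bool} | bisection c) 2^-1 ^+ #|V|)).
  rewrite sumr_const -[leRHS]mulr_natl exprVn ler_pdivlMr ?exprn_gt0 //.
  rewrite ler_pdivrMl ?ltr0n // -natrX -natrM ler_nat.
  by apply: leq_trans (card_bisections V) _; rewrite cardsE.
apply: ler_sum => c bc.
rewrite (expect_iid_prod row (fun v W => (majority_in c v W)%:R)).
have -> : 2^-1 ^+ #|V| = \prod_(v : V) 2^-1 :> R by rewrite prodr_const.
apply: ler_prod => v _; rewrite invr_ge0 ler0n /=.
exact: (majority_in_half (bernoulli_distribution p01) v bc).
Qed.

Hypothesis eta_bound : forall c : {ffun V -> bool},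
  expect row (fun W => (`|imbalance c W| <= 1)%R%:R) <= eta.

(** For a pair [(c, c')] every vertex [v] contributes the probability that both
    imbalances lie on the sides prescribed by [(c v, c' v)].  Two of these four
    events can meet only where an imbalance is in [-1, 1], so the probabilities
    add up to at most [1 + 3 eta], whatever the overlap of [c] and [c'].  The
    pair then enters only through these four weights. *)
Lemma perfect_bisections_second_moment K : (0 < K)%N ->
  expect (iid row) (fun f => perfect_bisections f ^+ 2) <=
    (K.+2 ^ 4)%:R * (1 + 3 * eta + 4 / K%:R) ^+ #|V|.
Proof.
move=> K0.
(* A pair of two-colourings is one colouring with four colours. *)
pose fst_c (d : {ffun V -> bool * bool}) := [ffun v => (d v).1].
pose snd_c (d : {ffun V -> bool * bool}) := [ffun v => (d v).2].
pose Q d (x : bool * bool) := expect row (fun W =>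
  (on_side x.1 (imbalance (fst_c d) W) &&
   on_side x.2 (imbalance (snd_c d) W))%:R).
have eta0 : 0 <= eta.
  by apply: le_trans (eta_bound [ffun=> true]); apply: expect_ge0.
apply: le_trans (_ : \sum_d \prod_v Q d (d v) <= _); last first.
  have -> : 4%N = #|{: bool * bool}| by rewrite card_prod card_bool.
  apply: sum_coloured_prod_le => //; first by lra.
    move=> d x; rewrite expect_ge0 //=; apply: expect_le1 => // W.
    by case: (_ && _).
  move=> d; rewrite -expect_sum.
  apply: le_trans (ler_expect rowP (fun W => sum_on_side_le R _ _)) _.
  rewrite !expectD expectZ expect_cst //.
  by have := eta_bound (fst_c d); have := eta_bound (snd_c d); lra.
apply: (@le_trans _ _ (\sum_(c : {ffun V -> bool}) \sum_(c' : {ffun V -> bool})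
    \prod_v expect row
      (fun W => (majority_in c v W && majority_in c' v W)%:R))).
  have perfect0 f c : 0 <= perfect f c by apply: prodr_ge0.
  rewrite (_ : \sum_c _ =
      expect (iid row) (fun f => (\sum_c perfect f c) ^+ 2)).
    apply: (ler_expect (iid_distribution V rowP)) => f.
    rewrite lerXn2r ?nnegrE ?sumr_ge0 //.
    by rewrite [leRHS](bigID (@bisection V)) /= lerDl sumr_ge0.
  under [RHS]eq_expect do rewrite expr2 big_distrlr.
  rewrite expect_sum; apply: eq_bigr => c _.
  rewrite expect_sum; apply: eq_bigr => c' _.
  rewrite -(expect_iid_prod row
    (fun v W => (majority_in c v W && majority_in c' v W)%:R)).
  apply: eq_expect => f.
  rewrite /= /perfect -big_split; apply: eq_bigr => v _ /=.
  by rewrite -mulnb natrM.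
rewrite pair_bigA /=.
pose h d := (fst_c d, snd_c d).
pose h' (cc : {ffun V -> bool} * {ffun V -> bool}) : {ffun V -> bool * bool} :=
  [ffun v => (cc.1 v, cc.2 v)].
rewrite (reindex h) /=; last first.
  exists h' => [d _|[c c'] _].
    by apply/ffunP => v; rewrite !ffunE; case: (d v).
  by rewrite /h; congr pair; apply/ffunP => v; rewrite !ffunE.
apply: ler_sum => d _; apply: ler_prod => v _; rewrite expect_ge0 //=.
apply: (ler_expect rowP) => W; rewrite ler_nat.
have -> : d v = (fst_c d v, snd_c d v) by rewrite !ffunE; case: (d v).
case: (boolP (majority_in (fst_c d) v W)) => //= /majority_in_side ->.
by case: (boolP (majority_in (snd_c d) v W)) => //= /majority_in_side ->.
Qed.

End Pairs.

(** * From positive probability to high probability *)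

Section MinDefects.
Variable V : finType.
Implicit Types (c W : {ffun V -> bool}) (f : {ffun V -> {ffun V -> bool}}).

Lemma bisection_exists : exists c, bisection c.
Proof.
have := card_bisections V.
case: (set_0Vmem [set c : {ffun V -> bool} | bisection c]).
  by move=> ->; rewrite cards0 muln0 leqn0 expn_eq0.
by case=> c; rewrite inE => bc _; exists c.
Qed.

Definition defects c f : nat := #|[set v | ~~ majority_in c v (f v)]|.

Definition best_bisection f : {ffun V -> bool} :=
  [arg min_(c < xchoose bisection_exists | bisection c) defects c f].

Definition min_defects f : nat := defects (best_bisection f) f.

Lemma best_bisectionP f : bisection (best_bisection f).
Proof. by rewrite /best_bisection; case: arg_minnP => //; exact: xchooseP. Qed.

Lemma min_defects_le c f : bisection c -> (min_defects f <= defects c f)%N.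
Proof.
rewrite /min_defects /best_bisection; case: arg_minnP; first exact: xchooseP.
by move=> c' _ h /h.
Qed.

Lemma min_defects_update f v W :
  (min_defects (update f v W) <= (min_defects f).+1)%N.
Proof.
apply: leq_trans (min_defects_le _ (best_bisectionP f)) _.
rewrite /min_defects /defects; set c := best_bisection f.
set S := [set u | ~~ majority_in c u (f u)].
apply: (@leq_trans #|v |: S|); last first.
  by rewrite cardsU1 -add1n leq_add2r; case: (_ \notin _).
apply: subset_leq_card; apply/fintype.subsetP => u; rewrite !inE ffunE.
by case: (eqVneq u v).
Qed.

Lemma min_defects_diff (R : realType) f v W :
  `|(min_defects (update f v W))%:R - (min_defects f)%:R| <= 1 :> R.
Proof.
have le1 := min_defects_update f v W.
have le2 := min_defects_update (update f v W) v (f v).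
have fE : update (update f v W) v (f v) = f.
  by apply/ffunP => u; rewrite !ffunE; case: eqP => [->|].
rewrite fE in le2; move: le1 le2; rewrite -!(ler_nat R) -!natr1 => le1 le2.
by rewrite ler_norml; lra.
Qed.

Variables (R : realType) (p eta lam : R) (K : nat).
Hypotheses (p01 : 0 <= p <= 1) (K_gt0 : (0 < K)%N) (lam_itv : 0 < lam <= 2^-1).
Hypothesis eta_bound : forall c,
  expect (iid (bernoulli p)) (fun W => (`|imbalance c W| <= 1)%R%:R) <= eta.
Hypothesis error_small : 3 * eta + 4 / K%:R <= lam ^+ 2.
Hypothesis poly_small :
  (#|V|.+1%:R) ^+ 2 * (K.+2 ^ 4)%:R <= expR (lam ^+ 2 * #|V|%:R).

(** By the second moment, some bisection has no defect with probability at least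
    [exp (- o(n))].  If the mean of [min_defects] were large, this event would be
    a deviation from it that bounded differences make even less likely. *)
Lemma min_defects_mean :
  expect (iid (iid (bernoulli p))) (fun f => (min_defects f)%:R) <=
    4 * lam * #|V|%:R.
Proof.
case/andP: lam_itv => lam0 lamh.
set row := iid (bernoulli p); set m := expect _ _; have poly := poly_small.
set n := #|V| in poly *.
have rowP : distribution row.
  exact: iid_distribution (bernoulli_distribution p01).
have fP := iid_distribution V rowP.
pose X := @perfect_bisections V R.
pose q := expect (iid row) (fun f => (X f != 0)%:R).
have q0 : 0 <= q by apply: expect_ge0.
have q_le : q <= expR (2 * lam ^+ 2 * n%:R) * expR (- lam * m).
  have lam_itv' : 0 <= lam <= 2^-1 by rewrite ltW.
  have := exp_moment_bounded_differences rowP lam_itv' (min_defects_diff R).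
  apply: le_trans; apply: (ler_expect fP) => f.
  case: eqP => [_|/eqP X0] /=; first exact/ltW/expR_gt0.
  suff -> : min_defects f = 0%N by rewrite mulr0 expR0.
  have [c bc cP] : exists2 c, bisection c & perfect R f c != 0.
    apply/exists_inP; apply: contraNT X0.
    rewrite negb_exists_in => /forall_inP no.
    by apply/eqP; apply: big1 => c /no /negPn/eqP.
  apply/eqP; rewrite -leqn0 (leq_trans (min_defects_le f bc)) //.
  rewrite leqn0 cards_eq0.
  apply/eqP/setP => v; rewrite !inE; apply/negbTE; rewrite negbK.
  by move: cP => /prodf_neq0 /(_ v isT); rewrite pnatr_eq0 eqb0 negbK.
have mean_ge := perfect_bisections_mean V p01.
have mean_gt0 : 0 < expect (iid row) X.
  by apply: lt_le_trans mean_ge; rewrite invr_gt0 ltr0n.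
have second := perfect_bisections_second_moment p01 eta_bound K_gt0.
have growth : (1 + 3 * eta + 4 / K%:R) ^+ n <= expR (lam ^+ 2 * n%:R).
  have eta0 : 0 <= eta.
    by apply: le_trans (eta_bound [ffun=> true]); apply: expect_ge0.
  have K0 : 0 <= 4 / K%:R :> R by rewrite divr_ge0.
  have base_le : 1 + 3 * eta + 4 / K%:R <= expR (lam ^+ 2).
    by apply: le_trans (expR_ge1Dx _); rewrite -addrA lerD2l.
  rewrite [lam ^+ 2 * _]mulrC expRM_natl.
  rewrite lerXn2r ?nnegrE ?(ltW (expR_gt0 _)) //.
  by rewrite !addr_ge0 // mulr_ge0.
have sm := second_moment_bound fP mean_gt0.
have lower : 1 <= n.+1%:R ^+ 2 * (K.+2 ^ 4)%:R * expR (lam ^+ 2 * n%:R) * q.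
  have n0 : 0 < n.+1%:R :> R by rewrite ltr0n.
  rewrite -2!mulrA -ler_pdivrMl ?exprn_gt0 // mulr1.
  apply: (@le_trans _ _ (expect (iid row) X ^+ 2)).
    rewrite -exprVn lerXn2r ?nnegrE ?invr_ge0 ?(ltW mean_gt0) ?(ltW n0) //.
  apply: le_trans sm _; rewrite mulrA; apply: ler_wpM2r => //.
  apply: le_trans second _; exact: ler_wpM2l.
have upper : 1 <= expR (4 * lam ^+ 2 * n%:R - lam * m).
  apply: le_trans lower _.
  have -> : 4 * lam ^+ 2 * n%:R - lam * m = lam ^+ 2 * n%:R + lam ^+ 2 * n%:R +
     (2 * lam ^+ 2 * n%:R + - lam * m) by ring.
  rewrite expRD [X in _ <= X * _]expRD [X in _ <= _ * X]expRD.
  by apply: ler_pM => //; apply: ler_wpM2r => //; exact/ltW/expR_gt0.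
have : 0 <= 4 * lam ^+ 2 * n%:R - lam * m by rewrite -ler_expR expR0.
rewrite (_ : _ - _ = lam * (4 * lam * n%:R - m)); last by ring.
by rewrite pmulr_rge0 // subr_ge0.
Qed.

End MinDefects.

(** * Random digraphs as families of independent rows *)

Section Rows.
Variable V : finType.

Definition digraph_of (f : {ffun V -> {ffun V -> bool}}) : digraph V :=
  [set e | f (val e).1 (val e).2].

Lemma out_nbrs_digraph_of f v :
  out_nbrs (digraph_of f) v = [set u | (u != v) && f v u].
Proof.
apply/setP => u; rewrite inE; apply/imsetP/andP => [[e]|[uv fvu]].
  rewrite !inE => /andP[fe /eqP ev] ->; rewrite -ev eq_sym; split=> //.
  exact: valP e.
have vuP : (v, u).1 != (v, u).2 by rewrite eq_sym.
by exists (exist _ (v, u) vuP) => //; rewrite !inE /= fvu eqxx.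
Qed.

Lemma majority_coloured_digraph_of f c v :
  majority_coloured (digraph_of f) c v = majority_in c v (f v).
Proof.
rewrite /majority_coloured /majority_in out_nbrs_digraph_of.
congr (_ * _ <= _)%N; congr #|pred_of_set _|.
by apply/setP => u; rewrite !inE.
Qed.

Lemma has_almost_majority_bisection_digraph_of (R : realType) (eps : R) f :
  (min_defects f)%:R <= eps * #|V|%:R ->
  has_almost_majority_bisection eps (digraph_of f).
Proof.
move=> le_eps; apply/existsP; exists (best_bisection f).
rewrite best_bisectionP /almost_majority.
rewrite (_ : [set v | _] =
  [set v | ~~ majority_in (best_bisection f) v (f v)]) //.
by apply/setP => v; rewrite !inE majority_coloured_digraph_of.
Qed.

End Rows.

Section Law.
Variables (R : realType) (n : nat) (p : R).
Hypothesis p01 : 0 <= p <= 1.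
Let row := iid (bernoulli p) : {ffun 'I_n -> bool} -> R.

(** The indicator that the digraph is [D] is a product over ordered pairs; its
    diagonal factors are [1], so the loops integrate out and the off-diagonal
    pairs give one factor per arc. *)
Lemma digraph_of_law (D : digraph 'I_n) :
  expect (iid row) (fun f => (digraph_of f == D)%:R) =
    binomial_digraph_mass p D.
Proof.
pose has_arc (v u : 'I_n) :=
  if insub (v, u) is Some e then e \in D else false.
have has_arcE (e : Defs.arc 'I_n) : has_arc (val e).1 (val e).2 = (e \in D).
  by rewrite /has_arc -surjective_pairing valK.
pose ok (v u : 'I_n) (b : bool) : R :=
  if v != u then (b == has_arc v u)%:R else 1.
have okE f : (digraph_of f == D)%:R = \prod_v \prod_u ok v u (f v u).
  case: eqP => [fD|neq].
    apply/esym; apply: big1 => v _; apply: big1 => u _; rewrite /ok.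
    case: ifP => // vu; have := has_arcE (exist _ (v, u) vu).
    by rewrite -fD inE /= => ->; rewrite eqxx.
  apply/esym/eqP; apply: contra_notT neq => /prodf_neq0 nz.
  apply/setP => e; rewrite inE.
  have /prodf_neq0/(_ (val e).2 isT) := nz (val e).1 isT.
  by rewrite /ok (valP e) has_arcE pnatr_eq0 eqb0 negbK => /eqP.
under eq_expect do rewrite okE.
rewrite (expect_iid_prod row (fun v W => \prod_u ok v u (W u))).
under eq_bigr do rewrite (expect_iid_prod (bernoulli p)).
rewrite pair_bigA /=.
rewrite (bigID (fun vu : 'I_n * 'I_n => vu.1 != vu.2)) /= mulrC.
rewrite big1 ?mul1r; last first.
  move=> [v u] /= /negbNE/eqP->; rewrite /ok eqxx /=.
  exact: expect_cst (bernoulli_distribution p01) _.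
pose arc_of : 'I_n * 'I_n -> option (Defs.arc 'I_n) := insub.
rewrite (reindex_omap val arc_of); last first.
  by move=> vu vuP; rewrite /arc_of insubT.
apply: eq_big => [e|e _]; first by rewrite /arc_of valK eqxx (valP e).
rewrite /expect big_bool /ok (valP e) has_arcE /bernoulli.
by case: (e \in D); rewrite /= !(mulr0, mulr1, addr0, add0r).
Qed.

Lemma binomial_digraph_prob_rows (E : pred (digraph 'I_n)) :
  binomial_digraph_prob p E = expect (iid row) (fun f => (E (digraph_of f))%:R).
Proof.
rewrite /binomial_digraph_prob.
under eq_bigr do rewrite -digraph_of_law.
rewrite -expect_sum; apply: eq_expect => f.
have [Ef|nEf] := boolP (E (digraph_of f)).
  rewrite (bigD1 (digraph_of f)) //= eqxx big1 ?addr0 // => D /andP[_].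
  by rewrite eq_sym => /negPf ->.
by rewrite big1 // => D ED; case: eqP => // fD; rewrite fD ED in nEf.
Qed.

End Law.

(** * The limit *)

Local Open Scope classical_set_scope.

Lemma min_defects_mean_small (R : realType) (p : nat -> R) (lam : R) :
  (forall n, 0 <= p n <= 1) ->
  n%:R * p n * (1 - p n) @[n --> \oo] --> +oo ->
  0 < lam <= 2^-1 ->
  \forall n \near \oo,
    expect (iid (iid (bernoulli (p n))))
      (fun f : {ffun 'I_n -> {ffun 'I_n -> bool}} => (min_defects f)%:R) <=
    4 * lam * n%:R.
Proof.
move=> p01 /cvgryPge hlim lam_itv; have /andP[lam0 _] := lam_itv.
have lam2 : 0 < lam ^+ 2 by rewrite exprn_gt0.
(* [eta] and [K] are such that [3 eta] and [4 / K] are at most [lam^2 / 2]. *)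
pose eta := lam ^+ 2 / 6.
have eta0 : 0 < eta by rewrite divr_gt0.
have [B _ hB] := imbalance_anticoncentration eta0.
pose K := (Num.trunc (8 / lam ^+ 2)).+1.
have K_large : 4 / K%:R <= lam ^+ 2 / 2.
  have /andP[_ /ltW le8] : (Num.trunc (8 / lam ^+ 2))%:R <= 8 / lam ^+ 2 < K%:R.
    by apply: truncn_itv; rewrite divr_ge0 // ltW.
  rewrite ler_pdivrMr ?ltr0n //.
  move: le8; rewrite ler_pdivrMr // mulrC; lra.
pose C : R := (K.+2 ^ 4)%:R.
have C0 : 0 < C by rewrite ltr0n expn_gt0.
near=> n.
have n1 : (0 < n)%N by near: n; exists 1%N.
have nB : B <= n%:R * p n * (1 - p n) by near: n; exact: hlim.
(* From [exp x >= x^3 / 6] and [(n + 1)^2 <= 4 n^2]. *)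
have nC : 24 * C / (lam ^+ 2) ^+ 3 <= n%:R.
  by near: n; exact: nbhs_infty_ger.
have := @min_defects_mean 'I_n R (p n) eta lam K (p01 n) isT lam_itv.
rewrite card_ord; apply.
- by move=> c; apply: hB => //; rewrite card_ord.
- by rewrite /eta; lra.
have n0 : 0 < n%:R :> R by rewrite ltr0n.
have x0 : 0 <= lam ^+ 2 * n%:R by rewrite mulr_ge0 ?ltW.
apply: le_trans (_ : (lam ^+ 2 * n%:R) ^+ 3 / 6 <= _); last first.
  by apply: le_trans (expR_ge1Dxn 2 x0); rewrite lerDr.
rewrite -/C; apply: (@le_trans _ _ ((2 * n%:R) ^+ 2 * C)).
  apply: ler_wpM2r; first exact: ltW.
  rewrite lerXn2r ?nnegrE ?mulr_ge0 // -natrM ler_nat; lia.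
move: nC; rewrite ler_pdivrMr ?exprn_gt0 // => nC.
rewrite ler_pdivlMr //.
have -> : (2 * n%:R) ^+ 2 * C * 6 = n%:R ^+ 2 * (24 * C) :> R by ring.
have -> : (lam ^+ 2 * n%:R) ^+ 3 = n%:R ^+ 2 * (n%:R * (lam ^+ 2) ^+ 3) by ring.
by apply: ler_wpM2l => //; exact: exprn_ge0.
Unshelve. all: by end_near.
Qed.

(** Markov's inequality at the threshold [eps n]. *)
Lemma almost_majority_bisection_prob (R : realType) (n : nat) (p eps : R) :
  0 <= p <= 1 -> (0 < n)%N -> 0 < eps ->
  expect (iid (iid (bernoulli p)))
    (fun f : {ffun 'I_n -> {ffun 'I_n -> bool}} => (min_defects f)%:R) <=
    eps ^+ 2 * n%:R ->
  1 - eps <= binomial_digraph_prob p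
    (fun D : digraph 'I_n => has_almost_majority_bisection eps D) <= 1.
Proof.
move=> p01 n0 eps0 mean_le; rewrite binomial_digraph_prob_rows //.
have fP := iid_distribution 'I_n
  (iid_distribution 'I_n (bernoulli_distribution p01)).
apply/andP; split; last first.
  by apply: (expect_le1 fP) => f; case: has_almost_majority_bisection.
have a0 : 0 < eps * n%:R by rewrite mulr_gt0 // ltr0n.
set a := eps * n%:R in a0.
apply: (@le_trans _ _ (expect (iid (iid (bernoulli p)))
    (fun f : {ffun 'I_n -> {ffun 'I_n -> bool}} =>
      1 + - a^-1 * (min_defects f)%:R))).
  rewrite expectD expectZ expect_cst // mulNr lerD2l lerN2 ler_pdivrMl //.
  by rewrite /a mulrAC -expr2.
apply: (ler_expect fP) => f.
have [le_a|gt_a] := leP (min_defects f)%:R a.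
  rewrite has_almost_majority_bisection_digraph_of ?card_ord //.
  by rewrite mulNr gerBl mulr_ge0 // invr_ge0 ltW.
apply: (@le_trans _ _ 0) => //; rewrite mulNr subr_le0.
by rewrite ler_pdivlMl // mulr1 ltW.
Qed.

Theorem theorem1p7 (R : realType) (p : nat -> R)
    (hp : forall n : nat, 0 <= p n <= 1)
    (hlim : n%:R * p n * (1 - p n) @[n --> \oo] --> +oo) :
  exists eps : nat -> R,
    eps n @[n --> \oo] --> (0 : R) /\
    binomial_digraph_prob (p n)
      (fun D : digraph 'I_n => has_almost_majority_bisection (eps n) D)
      @[n --> \oo] --> (1 : R).
Proof.
pose mean n := expect (iid (iid (bernoulli (p n))))
  (fun f : {ffun 'I_n -> {ffun 'I_n -> bool}} => (min_defects f)%:R).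
have mean0 n : 0 <= mean n.
  apply: expect_ge0 => //.
  exact: iid_distribution (iid_distribution _ (bernoulli_distribution (hp n))).
pose rt n := Num.sqrt (mean n / n%:R).
pose eps n : R := rt n + n.+1%:R^-1.
have rt_cvg : rt n @[n --> \oo] --> (0 : R).
  apply/cvgr0Pnorm_le => e e0.
  pose lam := Num.min 2^-1 (e ^+ 2 / 4).
  have lam_itv : 0 < lam <= 2^-1.
    by rewrite lt_min invr_gt0 ltr0n divr_gt0 ?exprn_gt0 //= ge_min lexx.
  have lam_e : 4 * lam <= e ^+ 2.
    by rewrite mulrC -ler_pdivlMr // ge_min lexx orbT.
  near=> n.
  have n0 : (0 < n)%N by near: n; exists 1%N.
  have mean_le : mean n <= 4 * lam * n%:R.
    by near: n; exact: min_defects_mean_small.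
  rewrite ger0_norm ?sqrtr_ge0 //.
  rewrite -[leRHS](ger0_norm (ltW e0)) -sqrtr_sqr ler_wsqrtr //.
  rewrite ler_pdivrMr ?ltr0n //; apply: le_trans mean_le _.
  exact: ler_wpM2r.
have eps_cvg : eps n @[n --> \oo] --> (0 : R).
  by rewrite -[X in _ --> X]addr0; apply: cvgD rt_cvg _; exact: cvg_harmonic.
exists eps; split => //.
have eps0 n : 0 < eps n by rewrite ltr_wpDl ?sqrtr_ge0 // invr_gt0 ltr0n.
apply: (squeeze_cvgr (f := fun n => 1 - eps n) (h := fun=> 1));
  last exact: cvg_cst.
  near=> n; have n0 : (0 < n)%N by near: n; exists 1%N.
  apply: almost_majority_bisection_prob => //.
  rewrite -/(mean n) -ler_pdivrMr ?ltr0n //.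
  have q0 : 0 <= mean n / n%:R by rewrite divr_ge0.
  have rt_le : rt n <= eps n by rewrite lerDl invr_ge0.
  by rewrite -(sqr_sqrtr q0) lerXn2r ?nnegrE ?sqrtr_ge0 ?(ltW (eps0 n)).
rewrite -[X in _ --> X]subr0; apply: cvgB eps_cvg; exact: cvg_cst.
Unshelve. all: by end_near.
Qed.
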